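(* For each real number $\mathfrak{D} \in (1,2]$ and each natural number $n \geq 3$, there exists an $n$-point metric space $(X,d)$ of scaled diameter $\mathfrak{D}$ whose maximal $p$-negative type is exactly $$\zeta(n,\mathfrak{D}) = \frac{\ln\bigl(\frac{1}{1-\Gamma}\bigr)}{\ln\mathfrak{D}}, \quad\text{where}\quad \Gamma = \frac12\left(\frac{1}{\lfloor n/2\rfloor}+\frac{1}{\lceil n/2\rceil}\right).$$
   Context: The scaled diameter of a finite metric space $(X,d)$ with at least two points is $\max_{x,y\in X} d(x,y) / \min\{d(x,y): x\neq y\}$. Convention for exponent $p=0$: $d(x,y)^0 = 1$ if $x\neq y$, and $d(x,x)^0=0$. For $p\ge 0$, a metric space $(X,d)$ has $p$-negative type if for all natural numbers $k \geq 2$, all finite subsets $\{x_1,\ldots,x_k\} \subseteq X$ (of $k$ distinct points), and all real numbers $\eta_1,\ldots,\eta_k$ with $\eta_1+\cdots+\eta_k = 0$, one has $\sum_{1\le i,j\le k} d(x_i,x_j)^p\eta_i\eta_j \leq 0$. The maximal $p$-negative type of $(X,d)$ is $\max\{p \ge 0 : (X,d) \text{ has } p\text{-negative type}\}$. *)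

(* Defs.v *)
From mathcomp Require Import all_boot all_order all_algebra.
From mathcomp Require Import all_classical all_reals all_analysis.

Set Implicit Arguments.
Unset Strict Implicit.
Unset Printing Implicit Defensive.

Import Order.TTheory GRing.Theory Num.Theory.

Local Open Scope classical_set_scope.
Local Open Scope ring_scope.

Definition is_max (R : realType) (A : set R) (m : R) : Prop :=
  A m /\ ubound A m.

Definition is_min (R : realType) (A : set R) (m : R) : Prop :=
  A m /\ lbound A m.

Definition has_scaled_diameter (R : realType) (X : metricType R) (D : R) : Prop :=
  exists M m : R,
    [/\ is_max [set r | exists x y : X, r = mdist x y] M,
        is_min [set r | exists x y : X, x <> y /\ r = mdist x y] m
      & D = M / m].

(* The case p = 0 is separate because powR has 0 `^ 0 = 1, whereas here
   d(x,x)^0 = 0. *)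
Definition mdist_pow (R : realType) (X : metricType R) (p : R) (x y : X) : R :=
  if p == 0 then (x != y)%:R else mdist x y `^ p.

Definition negative_type (R : realType) (X : metricType R) (p : R) : Prop :=
  forall (k : nat) (x : 'I_k -> X) (eta : 'I_k -> R),
    (2 <= k)%N -> injective x -> \sum_(i < k) eta i = 0 ->
    \sum_(i < k) \sum_(j < k) mdist_pow p (x i) (x j) * eta i * eta j <= 0.

Definition maximal_negative_type (R : realType) (X : metricType R) (p : R) : Prop :=
  is_max [set q | 0 <= q /\ negative_type X q] p.

Definition Gamma (R : realType) (n : nat) : R :=
  2^-1 * ((n./2)%:R^-1 + (uphalf n)%:R^-1).

Definition zeta (R : realType) (n : nat) (D : R) : R :=
  ln (1 / (1 - Gamma R n)) / ln D.

(* Main.v *)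
(** Split the [n] points into two blocks of sizes [n./2] and [uphalf n], put
    distance [1] between points of different blocks and [D] between distinct
    points of the same block.  If the weights [eta] sum to [0] and [s] is the
    total weight of one block, the form of exponent [p] is
    [2 (D^p - 1) s^2 - D^p \sum eta_i^2].  By Cauchy-Schwarz
    [\sum eta_i^2 >= 2 Gamma s^2], with equality when [eta] is constant on each
    block, so [p]-negative type means exactly [D^p (1 - Gamma) <= 1]. *)
Require Import Defs.
From HB Require Import structures.
From mathcomp Require Import all_boot all_order all_algebra.
From mathcomp Require Import all_classical all_reals all_analysis.
From mathcomp Require Import zify ring lra.

Set Implicit Arguments.
Unset Strict Implicit.
Unset Printing Implicit Defensive.

Import Order.TTheory GRing.Theory Num.Theory.

Local Open Scope classical_set_scope.
Local Open Scope ring_scope.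

(** Expand the sum of squared deviations from [t = s / m]. Only an upper bound on the cardinality is
    assumed, so that the lemma also serves for subsets of a block. *)
Lemma sum_sqr_ge (F : realFieldType) (I : finType) (P : pred I) (m : nat)
    (f : I -> F) : (#|P| <= m)%N ->
  (\sum_(i | P i) f i) ^+ 2 / m%:R <= \sum_(i | P i) f i ^+ 2.
Proof.
(* For [m = 0] the inverse is [0] by convention, so the left side vanishes. *)
case: m => [|m] Pm; first by rewrite invr0 mulr0 sumr_ge0// => i _; rewrite sqr_ge0.
set s := \sum_(i | P i) f i; pose t := s / m.+1%:R.
have : 0 <= \sum_(i | P i) (f i - t) ^+ 2 by rewrite sumr_ge0// => i _; rewrite sqr_ge0.
under eq_bigr do rewrite sqrrB -addrA.
rewrite big_split/= big_split/= sumrN sumrMnl -mulr_suml -/s sumr_const.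
have m0 : 0 < m.+1%:R :> F by rewrite ltr0n.
have Pt : t ^+ 2 *+ #|P| <= s ^+ 2 / m.+1%:R.
  rewrite -mulr_natr (@le_trans _ _ (t ^+ 2 * m.+1%:R))//.
    by rewrite ler_wpM2l ?sqr_ge0// ler_nat.
  by rewrite le_eqVlt; apply/orP; left; apply/eqP; rewrite /t; field; rewrite gt_eqF.
have -> : s * t *+ 2 = 2 * (s ^+ 2 / m.+1%:R) by rewrite /t; field; rewrite gt_eqF.
by move: Pt; move: (t ^+ 2 *+ _) (s ^+ 2 / _) => u v; lra.
Qed.

(** The parameter [c] stands for [D] in the metric and for [D^p] in the form of exponent [p]. *)
Definition block_dist (F : numFieldType) (T : eqType) (P : pred T) (c : F)
    (x y : T) : F :=
  if x == y then 0 else if P x == P y then c else 1.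

Lemma block_dist_inj (F : numFieldType) (T T' : eqType) (f : T -> T')
    (P : pred T') (c : F) (x y : T) : injective f ->
  block_dist P c (f x) (f y) = block_dist (P \o f) c x y.
Proof. by move=> f_inj; rewrite /block_dist inj_eq. Qed.

(** As a polynomial in the indicators of [P], the distance splits the double sum into products of
    single sums, and those with the factor [\sum_i eta i] vanish. *)
Lemma block_dist_form (F : numFieldType) (I : finType) (P : pred I) (c : F)
    (eta : I -> F) : \sum_i eta i = 0 ->
  \sum_i \sum_j block_dist P c i j * eta i * eta j =
  2 * (c - 1) * (\sum_(i | P i) eta i) ^+ 2 - c * \sum_i eta i ^+ 2.
Proof.
move=> eta0; set s := \sum_(i | P i) eta i.
have sE : s = \sum_i (P i)%:R * eta i.
  by rewrite /s big_mkcond; apply: eq_bigr => i _; case: (P i); rewrite ?mul1r ?mul0r.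
have row i : \sum_j block_dist P c i j * eta i * eta j =
    (1 - c) * s * eta i - 2 * (1 - c) * s * ((P i)%:R * eta i) - c * eta i ^+ 2.
  (* The coefficient is [c + (1 - c) (u + v - 2 u v)] for the indicators [u], [v] of [i], [j]: [c]
     if they agree, [1] if not. The last term cancels the diagonal. *)
  have wE j : block_dist P c i j * eta i * eta j =
      (c + (1 - c) * (P i)%:R) * eta i * eta j
      + (1 - c) * (1 - 2 * (P i)%:R) * eta i * ((P j)%:R * eta j)
      - (if j == i then c * eta i ^+ 2 else 0).
    rewrite /block_dist eq_sym; case: eqVneq => [->|_].
      by case: (P i) => /=; ring.
    by case: (P i); case: (P j) => /=; ring.
  under eq_bigr do rewrite wE.
  rewrite big_split/= big_split/= sumrN -!mulr_sumr -big_mkcond big_pred1_eq.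
  by rewrite eta0 -sE; ring.
under eq_bigr do rewrite row.
rewrite big_split/= big_split/= !sumrN -!mulr_sumr eta0 -sE.
by ring.
Qed.

Lemma block_dist_eq0 (F : numFieldType) (T : eqType) (P : pred T) (c : F)
    (x y : T) : 1 <= c -> block_dist P c x y = 0 -> x = y.
Proof.
move=> c1; rewrite /block_dist; case: eqVneq => // _ /eqP.
by case: ifP => _; rewrite gt_eqF// (lt_le_trans ltr01).
Qed.

Lemma block_dist_sym (F : numFieldType) (T : eqType) (P : pred T) (c : F)
    (x y : T) : block_dist P c x y = block_dist P c y x.
Proof. by rewrite /block_dist eq_sym (eq_sym (P x)). Qed.

(** Nonzero distances lie in [[1, 2]], so two of them add up to at least any third. *)
Lemma block_dist_triangle (F : realFieldType) (T : eqType) (P : pred T) (c : F)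
    (y x z : T) : 1 <= c <= 2 ->
  block_dist P c x z <= block_dist P c x y + block_dist P c y z.
Proof.
move=> /andP[c1 c2]; rewrite /block_dist.
have [->|xy] := eqVneq x y; first by rewrite add0r.
have [<-|yz] := eqVneq y z; first by rewrite (negbTE xy) addr0.
by case: (x == z); case: (P x); case: (P y); case: (P z) => /=; lra.
Qed.

(** An alias of [T] carrying [c12], so that the metric structure, which needs the
    bounds on [c], can be declared as an instance. *)
Definition block_space (R : realType) (T : choiceType) (P : pred T) (c : R)
  (c12 : 1 <= c <= 2) : Type := T.

Section BlockSpace.
Context (R : realType) (T : choiceType) (P : pred T) (c : R) (c12 : 1 <= c <= 2).

HB.instance Definition _ := Choice.on (block_space P c12).

Let block_distxx (x : T) : block_dist P c x x = 0.
Proof. by rewrite /block_dist eqxx. Qed.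

HB.instance Definition _ := isMetric.Build R (block_space P c12) block_distxx
  (fun x y => @block_dist_eq0 R T P c x y (proj1 (andP c12)))
  (@block_dist_sym R T P c)
  (fun y x z => @block_dist_triangle R T P c y x z c12).

End BlockSpace.

Lemma block_space_mdist_pow (R : realType) (T : choiceType) (P : pred T) (c : R)
    (c12 : 1 <= c <= 2) (p : R) (x y : block_space P c12) :
  mdist_pow p x y = block_dist P (c `^ p) x y.
Proof.
rewrite /mdist_pow; change (mdist x y) with (block_dist P c x y).
rewrite /block_dist; have [->|p0] := eqVneq p 0.
  by rewrite powRr0; case: eqVneq => //; case: ifP.
by case: eqVneq => _; [rewrite powR0|case: ifP; rewrite ?powR1].
Qed.

Lemma block_space_scaled_diameter (R : realType) (T : choiceType) (P : pred T)
    (c : R) (c12 : 1 <= c <= 2) (x y z : T) :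
  x <> y -> P x = P y -> P x <> P z ->
  has_scaled_diameter (block_space P c12) c.
Proof.
move=> /eqP xy Pxy /eqP Pxz; have /andP[c1 _] := c12.
have dE (u v : block_space P c12) : mdist u v = block_dist P c u v by [].
exists c, 1; split; last by rewrite divr1.
- split; first by exists x, y; rewrite dE /block_dist (negbTE xy) Pxy eqxx.
  move=> _ [u [v ->]]; rewrite dE /block_dist.
  by case: eqP => _; [lra|case: ifP].
- split.
    have xz : x != z by apply: contraNneq Pxz => ->.
    exists x, z; rewrite dE /block_dist (negbTE Pxz) (negbTE xz).
    by split => //; exact/eqP.
  move=> _ [u [v [/eqP uv ->]]]; rewrite dE /block_dist (negbTE uv).
  by case: ifP.
Qed.

Lemma block_space_negative_type (R : realType) (n : nat) (P : pred 'I_n) (c : R)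
    (c12 : 1 <= c <= 2) (p : R) : (0 < #|P|)%N -> (0 < #|predC P|)%N ->
  negative_type (block_space P c12) p <->
  c `^ p * (1 - 2^-1 * (#|P|%:R^-1 + #|predC P|%:R^-1)) <= 1.
Proof.
move=> P_gt0 Q_gt0; set a := #|P|; set b := #|predC P|.
have a0 : 0 < a%:R :> R by rewrite ltr0n.
have b0 : 0 < b%:R :> R by rewrite ltr0n.
split=> [neg|cp k x eta _ x_inj eta0].
(* The equality case of Cauchy-Schwarz, scaled to block weights [1] and [-1]. *)
- pose eta i : R := if P i then a%:R^-1 else - b%:R^-1.
  have sP : \sum_(i | P i) eta i = 1.
    rewrite (eq_bigr (fun=> a%:R^-1)) => [|i Pi]; last by rewrite /eta Pi.
    by rewrite sumr_const -(mulr_natr _^-1) mulVf ?gt_eqF.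
  have eta0 : \sum_i eta i = 0.
    rewrite (bigID P)/= sP (eq_bigr (fun=> - b%:R^-1)) => [|i /negbTE Pi].
      by rewrite (sumr_const (predC P)) -(mulr_natr (- _)) mulNr mulVf ?gt_eqF// subrr.
    by rewrite /eta Pi.
  have etaS : \sum_i eta i ^+ 2 = a%:R^-1 + b%:R^-1.
    rewrite (bigID P)/= (eq_bigr (fun=> a%:R^-1 ^+ 2)) => [|i Pi]; last first.
      by rewrite /eta Pi.
    rewrite [X in _ + X](eq_bigr (fun=> b%:R^-1 ^+ 2)) => [|i /negbTE Pi].
      rewrite sumr_const (sumr_const (predC P)) -!(mulr_natr (_ ^+ 2)) -/a -/b.
      by field; rewrite !gt_eqF.
    by rewrite /eta Pi sqrrN.
  have n2 : (2 <= n)%N.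
    by have := leq_add P_gt0 Q_gt0; rewrite cardC card_ord.
  have := neg n id eta n2 (@inj_id _) eta0.
  under eq_bigr do under eq_bigr do rewrite block_space_mdist_pow.
  by rewrite block_dist_form// sP etaS; lra.
- under eq_bigr do under eq_bigr do
    rewrite block_space_mdist_pow (@block_dist_inj R _ 'I_n x _ _ _ _ x_inj).
  rewrite block_dist_form//; set s := \sum_(i | _) _; set S := \sum_i _.
  (* The tested points may miss part of a block, so each block size is only an upper bound here. *)
  have card_le (Q : pred 'I_n) : (#|[pred i | Q (x i)]| <= #|Q|)%N.
    rewrite -(@fintype.card_image _ 'I_n x x_inj).
    apply/subset_leq_card/fintype.subsetP => y.
    by move=> /fintype.imageP[i Qi ->].
  have sC : \sum_(i | ~~ P (x i)) eta i = - s.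
    move: eta0; rewrite (bigID (P \o x))/= addrC => /eqP.
    by rewrite addr_eq0 => /eqP.
  have S_ge : s ^+ 2 / a%:R + s ^+ 2 / b%:R <= S.
    rewrite /S (bigID (P \o x))/= -[X in _ + X / _]sqrrN -sC lerD//.
      exact: sum_sqr_ge (card_le P).
    exact: sum_sqr_ge (card_le (predC P)).
  (* With [g] the mean of [1/a] and [1/b], the form is at most [2 s^2 (c^p (1 - g) - 1)], which is
     nonpositive by [cp]. *)
  have := ler_wpM2l (powR_ge0 c p) S_ge.
  have := ler_wpM2l (sqr_ge0 s) cp.
  by lra.
Qed.

Lemma powR_mul_le1 (R : realType) (c g q : R) : 1 < c -> 0 < g ->
  (c `^ q * g <= 1) = (q <= ln (1 / g) / ln c).
Proof.
move=> c1 g0; have c0 : 0 < c by lra.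
rewrite -ler_pdivlMr// [RHS]ler_pdivlMr ?ln_gt0// -ln_powR ler_ln ?posrE ?powR_gt0//.
by rewrite divr_gt0.
Qed.

Lemma card_ord_lt (n m : nat) : (m <= n)%N -> #|[pred i : 'I_n | (i < m)%N]| = m.
Proof.
by move=> mn; rewrite -sum1_card (big_ord_narrow mn) sum1_card card_ord.
Qed.

Theorem mainTheorem2 (R : realType) (D : R) (n : nat)
  (hD1 : 1 < D) (hD2 : D <= 2) (hn : (3 <= n)%N) :
  exists X : metricType R,
    [/\ ([set: X] #= `I_n)%card,
        has_scaled_diameter X D
      & maximal_negative_type X (zeta n D)].
Proof.
have D12 : 1 <= D <= 2 by rewrite ltW.
pose P : pred 'I_n := [pred i : 'I_n | (i < n./2)%N].
have n_half : (n./2 + uphalf n = n)%N.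
  by rewrite uphalf_half addnCA addnn odd_double_half.
have half_gt0 : (0 < n./2)%N by case: n hn {P n_half} => [|[|[]]].
have uphalf_gt1 : (1 < uphalf n)%N by case: n hn {P n_half half_gt0} => [|[|[|[]]]].
have cardP : #|P| = n./2 by rewrite card_ord_lt// -{2}n_half leq_addr.
have cardC : #|predC P| = uphalf n.
  by apply/eqP; rewrite -(eqn_add2l n./2) -{1}cardP cardC card_ord n_half.
(* Since [n >= 3], the larger block has at least two points, so [Gamma <= 3/4]; for [n = 2] it would
   be [1]. *)
have G_lt1 : 0 < 1 - Gamma R n.
  have : (n./2)%:R^-1 <= 1 :> R by rewrite invf_le1 ?ltr0n// ler1n.
  have : (uphalf n)%:R^-1 <= 2^-1 :> R.
    by rewrite lef_pV2 ?posrE ?ltr0n ?ler_nat// ltnW.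
  by rewrite /Gamma; lra.
have negE q : negative_type (block_space P D12) q <-> q <= zeta n D.
  by rewrite /zeta -powR_mul_le1// block_space_negative_type ?cardP ?cardC// ltnW.
exists (block_space P D12); split.
- by rewrite card_eq_sym; exact: card_II.
- have lt0 : (0 < n)%N by rewrite (leq_trans _ hn).
  have lt1 : (n.-1 < n)%N by rewrite prednK.
  have lt2 : (n.-2 < n)%N by rewrite (leq_ltn_trans _ lt1)// leq_pred.
  (* The last two points share the larger block, and point [0] lies in the other. *)
  apply: (@block_space_scaled_diameter R 'I_n P D D12
    (Ordinal lt1) (Ordinal lt2) (Ordinal lt0)).
  + by case; move: hn; case: (n) => [|[|[]]] //= m _ /eqP; rewrite eqn_leq ltnn.
  + have [le1 le2] : (n./2 <= n.-1)%N /\ (n./2 <= n.-2)%N.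
      by move: n_half uphalf_gt1; lia.
    by rewrite /P/= !ltnNge le1 le2.
  + by rewrite /P/= half_gt0; move: n_half uphalf_gt1; lia.
- split=> [|q [_ /negE//]].
  split; last exact/negE.
  (* Nonnegativity of [zeta] is the threshold criterion at exponent [0], that is
     [1 - Gamma <= 1]. *)
  rewrite /zeta -powR_mul_le1// powRr0 mul1r lerBlDr lerDl.
  by rewrite /Gamma mulr_ge0 ?addr_ge0 ?invr_ge0.
Qed.
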